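(* Let $\mu = e^{-V}\,dx$ and $\nu = e^{-W}\,dx$ be probability measures on $\mathbb{R}^d$, let $\nabla\Phi$ be the optimal transportation mapping pushing $\mu$ forward onto $\nu$, let $g = D^2\Phi$, and let $M=(\mathbb{R}^d, g, \mu)$ be the associated metric-measure space, where $\mu = e^{-P}\,d\mathrm{vol}_M$ with $P = \frac12\bigl(V + W(\nabla\Phi)\bigr)$. Assume that $V$ and $W$ are convex. Then the Bakry--Émery tensor $\mathrm{Ric} + D^2_M P$ of $M$ is non-negative, i.e. $(\mathrm{Ric} + D^2_M P)(\xi,\xi)\ge 0$ for every tangent vector $\xi$ at every point.
   Context: Standing assumptions: $V$, $W$, the convex potential $\Phi$ and its Legendre transform $\Psi=\Phi^*$ are smooth functions on $\mathbb{R}^d$; $\nabla\Phi$ pushes $\mu$ forward onto $\nu$, and $\nabla\Phi,\nabla\Psi$ are mutually inverse, so that $D^2\Phi(x)\cdot D^2\Psi(\nabla\Phi(x))=\mathrm{Id}$ and $D^2\Phi$ is everywhere positive definite. The change of variables (Monge--Ampère) equation $e^{-V} = e^{-W(\nabla\Phi)}\det D^2\Phi$ holds. The Riemannian metric on $\mathbb{R}^d$ is $g_{ij}=\partial_{x_i}\partial_{x_j}\Phi$ in the standard coordinates; $\mathrm{Ric}$, $D^2_M$ (Riemannian Hessian, $D^2_M f(X,Y)=\langle\nabla_X\nabla_M f,Y\rangle_M$) and $\mathrm{vol}_M=\sqrt{\det g}\,dx$ are taken with respect to $g$. *)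

(* Defs.v *)
From HB Require Import structures.
From mathcomp Require Import all_boot all_order all_algebra.
From mathcomp Require Import all_classical all_reals all_analysis.

Set Implicit Arguments.
Unset Strict Implicit.
Unset Printing Implicit Defensive.

Import Order.TTheory GRing.Theory Num.Theory.
Import numFieldNormedType.Exports.

Local Open Scope classical_set_scope.
Local Open Scope ring_scope.

(* As for n.-tuple, the sigma-algebra on 'rV[R]_n is the
   one generated by the coordinates, i.e. the Borel sigma-algebra of R^n. *)
Definition rV_display : measure_display -> measure_display.
Proof. exact. Qed.

Section measurable_rV.
Context (R : realType) (n : nat).

Let coord (i : 'I_n) (x : 'rV[R]_n) : measurableTypeR R := x ord0 i.

Let rV_set0 : g_sigma_preimage coord set0.
Proof. exact: sigma_algebra0. Qed.

Let rV_setC A : g_sigma_preimage coord A -> g_sigma_preimage coord (~` A).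
Proof. exact: sigma_algebraC. Qed.

Let rV_bigcup (F : _^nat) : (forall i, g_sigma_preimage coord (F i)) ->
  g_sigma_preimage coord (\bigcup_i (F i)).
Proof. exact: sigma_algebra_bigcup. Qed.

HB.instance Definition _ :=
  @isMeasurable.Build (rV_display default_measure_display) 'rV[R]_n
    (g_sigma_preimage coord) rV_set0 rV_setC rV_bigcup.

Lemma measurable_rV_coord (i : 'I_n) :
  measurable_fun [set: 'rV[R]_n]
    (fun x : 'rV[R]_n => x ord0 i : measurableTypeR R).
Proof.
move=> _ Y mY; rewrite setTI; apply: sub_sigma_algebra => /=.
rewrite -bigcup_seq/=; exists i => /=; first by rewrite mem_index_enum.
by exists Y => //; rewrite setTI.
Qed.

Lemma measurable_fun_rV d (T : measurableType d) (f : T -> 'rV[R]_n) :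
  (forall i, measurable_fun [set: T] (fun t => f t ord0 i : measurableTypeR R)) ->
  measurable_fun [set: T] f.
Proof.
move=> mf; suff: g_sigma_preimage (fun i => coord i \o f) `<=` measurable.
  by rewrite g_sigma_preimage_comp => prefS _ A mA; apply: prefS; exists A.
apply: smallest_sub; first exact: sigma_algebra_measurable.
by rewrite -bigcup_seq/= => A [i _ [B mB <-]]; exact: mf.
Qed.

End measurable_rV.

Section lebesgue_rV.
Context (R : realType).

Definition cons_rV n (p : measurableTypeR R * 'rV[R]_n) : 'rV[R]_n.+1 :=
  \row_i (if unlift ord0 i is Some j then p.2 ord0 j else p.1).

Definition uncons_rV n (v : 'rV[R]_n.+1) : measurableTypeR R * 'rV[R]_n :=
  (v ord0 ord0, \row_j v ord0 (lift ord0 j)).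

Lemma cons_rVK n : cancel (@cons_rV n) (@uncons_rV n).
Proof.
move=> [x v]; rewrite /uncons_rV !mxE unlift_none; congr pair.
by apply/rowP => j; rewrite !mxE liftK.
Qed.

Lemma uncons_rVK n : cancel (@uncons_rV n) (@cons_rV n).
Proof.
move=> v; apply/rowP => i; rewrite !mxE.
by case: unliftP => [j|] ->; rewrite ?mxE.
Qed.

Lemma measurable_cons_rV n : measurable_fun setT (@cons_rV n).
Proof.
apply: measurable_fun_rV => i; case: (unliftP ord0 i) => [j|] ->.
- rewrite (_ : (fun _ => _) = (fun v : 'rV[R]_n => v ord0 j) \o snd).
    by apply: measurableT_comp => //; exact: measurable_rV_coord.
  by apply/funext => p; rewrite !mxE liftK.
- rewrite (_ : (fun _ => _) = fst)//.
  by apply/funext => p; rewrite !mxE unlift_none.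
Qed.

Lemma measurable_uncons_rV n : measurable_fun setT (@uncons_rV n).
Proof.
apply/measurable_fun_pairP; split; first exact: measurable_rV_coord.
apply: measurable_fun_rV => i.
rewrite (_ : (fun _ => _) = fun v : 'rV[R]_n.+1 => v ord0 (lift ord0 i)).
  exact: measurable_rV_coord.
by apply/funext => v; rewrite /= mxE.
Qed.

Section lebesgue_step.
Context n (m : {sigma_finite_measure set 'rV[R]_n -> \bar R}).

Definition lebesgue_step : set 'rV[R]_n.+1 -> \bar R :=
  pushforward (@lebesgue_measure R \x m)%E (@cons_rV n).

Let mpre A : measurable A -> measurable (@cons_rV n @^-1` A).
Proof. by move=> mA; rewrite -[X in measurable X]setTI; exact: measurable_cons_rV. Qed.

Let step0 : lebesgue_step set0 = 0%E.
Proof. by rewrite /lebesgue_step /pushforward preimage_set0 measure0. Qed.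

Let step_ge0 A : (0 <= lebesgue_step A)%E.
Proof. by rewrite /lebesgue_step /pushforward; exact: measure_ge0. Qed.

Let step_sigma_additive : semi_sigma_additive lebesgue_step.
Proof.
move=> F mF tF mUF; rewrite /lebesgue_step /pushforward preimage_bigcup.
apply: measure_semi_sigma_additive.
- by move=> i; exact: mpre.
- apply/trivIsetP => /= i j _ _ ij; rewrite -preimage_setI.
  by move/trivIsetP : tF => /(_ _ _ _ _ ij) ->//; rewrite preimage_set0.
- by rewrite -preimage_bigcup; exact: mpre.
Qed.

HB.instance Definition _ :=
  isMeasure.Build _ _ _ lebesgue_step step0 step_ge0 step_sigma_additive.

Let step_sigma_finite : sigma_finite setT lebesgue_step.
Proof.
have /sigma_finiteP[F [FT ndF Foo]] := sigma_finiteT (@lebesgue_measure R).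
have /sigma_finiteP[G [GT ndG Goo]] := sigma_finiteT m.
exists (fun k => @uncons_rV n @^-1` (F k `*` G k)).
  rewrite predeqE => v; split=> // _.
  have [k _ Fk] : (\bigcup_i F i) (uncons_rV v).1 by rewrite -FT.
  have [l _ Gl] : (\bigcup_i G i) (uncons_rV v).2 by rewrite -GT.
  exists (maxn k l) => //; split.
    by move: Fk; apply/subsetPset/ndF/leq_maxl.
  by move: Gl; apply/subsetPset/ndG/leq_maxr.
move=> k; have [mF Fk] := Foo k; have [mG Gk] := Goo k; split.
  rewrite -[X in measurable X]setTI.
  by apply: measurable_uncons_rV => //; exact: measurableX.
rewrite /lebesgue_step /pushforward -comp_preimage.
rewrite (_ : _ \o _ = id) ?preimage_id; last first.
  by apply/funext => p; exact: cons_rVK.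
by rewrite product_measure1E// lte_mul_pinfty// ge0_fin_numE.
Qed.

HB.instance Definition _ :=
  Measure_isSigmaFinite.Build _ _ _ lebesgue_step step_sigma_finite.

End lebesgue_step.

Fixpoint lebesgue_rV n : {sigma_finite_measure set 'rV[R]_n -> \bar R} :=
  match n with
  | 0 => \d_(0 : 'rV[R]_0)
  | n'.+1 => lebesgue_step (lebesgue_rV n')
  end.

Lemma lebesgue_rV_box n (A : 'I_n -> set (measurableTypeR R)) :
  (forall i, measurable (A i)) ->
  lebesgue_rV n [set x | forall i, A i (x ord0 i)] =
  (\prod_(i < n) lebesgue_measure (A i))%E.
Proof.
elim: n A => [|n IH] A mA.
  by rewrite big_ord0 /= diracE mem_set// => -[].
pose B := [set v : 'rV[R]_n | forall i, A (lift ord0 i) (v ord0 i)].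
have mB : measurable B.
  rewrite (_ : B =
    \bigcap_(i : 'I_n) (fun x : 'rV[R]_n => x ord0 i) @^-1` A (lift ord0 i)).
    apply: fin_bigcap_measurable => // i _.
    rewrite -[X in measurable X]setTI.
    by apply: measurable_rV_coord => //; exact: mA.
  by apply/seteqP; split=> x /= Ax i; [move=> _|]; exact: Ax.
rewrite big_ord_recl -IH// -product_measure1E//.
congr product_measure1; apply/seteqP; split=> [[x v]|[x v] [/= Ax Av] i].
  move=> /= Axv; split => [|i].
    by have := Axv ord0; rewrite mxE unlift_none.
  by have := Axv (lift ord0 i); rewrite mxE liftK.
by rewrite mxE; case: unliftP => [j|] ->.
Qed.

End lebesgue_rV.

Section calculus.
Context (R : realType) (d : nat).
Implicit Types (f : 'rV[R]_d -> R) (x y : 'rV[R]_d).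

Definition partial (i : 'I_d) f x : R := 'D_(delta_mx ord0 i) f x.

(* C^infinity: every iterated partial derivative is Frechet differentiable at
   every point, hence also continuous. *)
Definition smooth f : Prop :=
  forall (s : seq 'I_d) x, differentiable (foldr partial f s) x.

Definition gradient f x : 'rV[R]_d := \row_i partial i f x.

Definition hessian f x : 'M[R]_d := \matrix_(i, j) partial i (partial j f) x.

Definition convex f : Prop :=
  convex_function (setT : set (convex_lmodType 'rV[R]_d)) f.

Definition dotp x y : R := (x *m y^T) ord0 ord0.

Definition posdef (A : 'M[R]_d) : Prop :=
  forall xi : 'rV[R]_d, xi != 0 -> 0 < dotp (xi *m A) xi.

Definition is_legendre_transform (Phi Psi : 'rV[R]_d -> R) : Prop :=
  forall y, (Psi y)%:E = ereal_sup (range (fun x => (dotp x y - Phi x)%:E)).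

Definition has_density (mu : set 'rV[R]_d -> \bar R) f : Prop :=
  forall A, measurable A -> mu A = (\int[@lebesgue_rV R d]_(x in A) (f x)%:E)%E.

End calculus.

(* Riemannian geometry of a metric g on R^d, in the global standard chart;
   tangent vectors are row vectors of components. *)
Section riemannian.
Context (R : realType) (d : nat).
Local Notation point := 'rV[R]_d.
Local Notation vector_field := (point -> 'rV[R]_d).
Variable g : point -> 'M[R]_d.
Implicit Types (f : point -> R) (X Y Z : vector_field) (x : point).

Definition inner x (xi eta : 'rV[R]_d) : R := dotp (xi *m g x) eta.

Definition vol_density x : R := Num.sqrt (\det (g x)).

(* Gamma^k_ij; derivatives of g are taken entrywise *)
Definition christoffel (k i j : 'I_d) x : R :=
  2^-1 * \sum_l invmx (g x) k l *
    (partial i (fun y => g y j l) x + partial j (fun y => g y i l) x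
     - partial l (fun y => g y i j) x).

(* nabla_X Y for the Levi-Civita connection *)
Definition covariant_derivative X Y : vector_field := fun x =>
  'D_(X x) Y x
  + \row_k \sum_i \sum_j christoffel k i j x * X x ord0 i * Y x ord0 j.

Definition lie_bracket X Y : vector_field := fun x =>
  'D_(X x) Y x - 'D_(Y x) X x.

Definition curvature X Y Z : vector_field := fun x =>
  covariant_derivative X (covariant_derivative Y Z) x
  - covariant_derivative Y (covariant_derivative X Z) x
  - covariant_derivative (lie_bracket X Y) Z x.

(* Ric(xi, eta) is the trace of zeta |-> R(zeta, xi) eta. Curvature and Hessian
   are tensorial, so tangent vectors are extended to constant fields. *)
Definition ricci x (xi eta : 'rV[R]_d) : R :=
  \sum_i curvature (cst (delta_mx ord0 i)) (cst xi) (cst eta) x ord0 i.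

Definition riem_gradient f : vector_field := fun x =>
  gradient f x *m invmx (g x).

Definition riem_hessian f x (xi eta : 'rV[R]_d) : R :=
  inner x (covariant_derivative (cst xi) (riem_gradient f) x) eta.

(* The Bakry-Emery tensor of (R^d, g, exp(-P) dvol_g). *)
Definition bakry_emery (P : point -> R) x (xi eta : 'rV[R]_d) : R :=
  ricci x xi eta + riem_hessian P x xi eta.

End riemannian.

(* Main.v *)
(* Write g = D^2 Phi, A(u) for the derivative of g along u, and
   B(u) = A(u) g^-1 / 2. Since the third derivatives of Phi are symmetric, the
   Levi-Civita connection is nabla_u = D_u + B(u), with B(u) acting on row
   vectors from the right, the fourth derivatives cancel in the curvature, and
     Ric(xi, xi) = tr B(xi)^2 - tr B(eta),   eta = xi B(xi).
   The Riemannian Hessian of P at (xi, xi) is D_xi (grad P) . xi - grad P . eta.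
   The derivative of the logarithm of the Monge-Ampere equation along eta,
     D_eta V = D_eta (W o grad Phi) - 2 tr B(eta),
   makes all first-order terms cancel against - tr B(eta), and what remains is
     D^2 V(xi, xi) / 2 + D^2 W(xi g, xi g) / 2 + tr B(xi)^2.
   The last term is 1/4 of the squared Frobenius norm of L^-T A(xi) L^-1, where
   g = L^T L. *)
Require Import Defs.
From HB Require Import structures.
From mathcomp Require Import all_boot all_order all_algebra.
From mathcomp Require Import perm.
From mathcomp Require Import all_classical all_reals all_analysis.
From mathcomp Require Import ring lra.

Set Implicit Arguments.
Unset Strict Implicit.
Unset Printing Implicit Defensive.

Import Order.TTheory GRing.Theory Num.Theory.
Import numFieldNormedType.Exports.

Local Open Scope classical_set_scope.
Local Open Scope ring_scope.

(** * Directional derivatives of matrix-valued functions, determinants and compositions *)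

Section matrix_derivatives.
Context (R : realType) (V : normedModType R).
Implicit Types (x u : V).

Lemma is_derive_mxP m n (M : V -> 'M[R]_(m, n)) x u (M' : 'M[R]_(m, n)) :
  is_derive x u M M' <->
  forall i j, is_derive x u (fun y => M y i j) (M' i j).
Proof.
split=> [[dM <-] i j|dM].
  rewrite derive_mx// mxE; apply: derivableP.
  by move/derivable_mxP : dM.
have dM' : derivable M x u by apply/derivable_mxP => i j; exact: ex_derive.
apply: DeriveDef => //; rewrite derive_mx//; apply/matrixP => i j.
by rewrite mxE derive_val.
Qed.

Lemma is_derive_sumf (I : finType) (f : I -> V -> R) x u (f' : I -> R) :
  (forall i, is_derive x u (f i) (f' i)) ->
  is_derive x u (fun y => \sum_i f i y) (\sum_i f' i).
Proof.
move=> df; rewrite -fct_sumE.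
by elim/big_ind2 : _ => // *; [exact: is_derive_cst|exact: is_deriveD].
Qed.

Lemma is_derive_mulmx m n p (M : V -> 'M[R]_(m, n)) (N : V -> 'M[R]_(n, p))
    x u (M' : 'M[R]_(m, n)) (N' : 'M[R]_(n, p)) :
  is_derive x u M M' -> is_derive x u N N' ->
  is_derive x u (fun y => M y *m N y) (M' *m N x + M x *m N').
Proof.
move=> /is_derive_mxP dM /is_derive_mxP dN; apply/is_derive_mxP => i j.
rewrite !mxE -big_split/=.
have -> : (fun y => (M y *m N y) i j) = fun y => \sum_k M y i k * N y k j.
  by apply/funext => y; rewrite mxE.
apply: is_derive_sumf => k; rewrite addrC [X in _ + X]mulrC.
exact: (is_deriveM (f := fun y => M y i k) (g := fun y => N y k j)).
Qed.

(** Leibniz rule. The differentiated factor is left out by the test [k != i], which removes exactly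
    one factor because [r] has no duplicates. *)
Lemma is_derive_prod (I : eqType) (r : seq I) (f : I -> V -> R) x u
    (f' : I -> R) : uniq r -> (forall i, is_derive x u (f i) (f' i)) ->
  is_derive x u (fun y => \prod_(i <- r) f i y)
    (\sum_(k <- r) f' k * \prod_(i <- r | k != i) f i x).
Proof.
move=> + df; elim: r => [_|k r IH /= /andP[kr /IH dr]].
  rewrite big_nil; under eq_fun do rewrite big_nil; exact: is_derive_cst.
under eq_fun do rewrite big_cons.
rewrite big_cons big_cons eqxx/=.
have -> : \prod_(i <- r | k != i) f i x = \prod_(i <- r) f i x.
  rewrite big_seq_cond [RHS]big_seq; apply: eq_bigl => i.
  by case: (boolP (i \in r)) => //= ir; apply: contraNneq kr => ->.
apply: is_derive_eq (is_deriveM (df k) dr) _.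
rewrite addrC; congr (_ + _); first by rewrite mulrC.
rewrite /GRing.scale/= mulr_sumr; apply: eq_big_seq => i ir.
rewrite big_cons ifT; first by rewrite mulrCA.
by apply: contraNneq kr => <-.
Qed.

(** Jacobi's formula, obtained by differentiating the sum over permutations term by term. *)
Lemma is_derive_det n (M : V -> 'M[R]_n) x u (M' : 'M[R]_n) :
  is_derive x u M M' ->
  is_derive x u (fun y => \det (M y)) (\tr (M' *m \adj (M x))).
Proof.
move=> /is_derive_mxP dM.
have -> : \tr (M' *m \adj (M x)) = \sum_(s : {perm 'I_n}) (-1) ^+ s *
    \sum_k M' k (s k) * \prod_(i | k != i) M x i (s i).
  under [RHS]eq_bigr do rewrite mulr_sumr.
  rewrite exchange_big/=; apply: eq_bigr => k _; rewrite mxE.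
  (* For fixed row [k], the permutations sending [k] to [j] make up the expansion of the cofactor at
     [(k, j)]. *)
  rewrite (partition_big (fun s : {perm 'I_n} => s k) predT)//=.
  apply: eq_bigr => j _; rewrite mxE expand_cofactor mulr_sumr.
  by apply: eq_bigr => s /eqP ->; rewrite mulrCA.
apply: is_derive_sumf => s.
have ds := @is_derive_prod 'I_n (index_enum 'I_n) (fun i y => M y i (s i)) x u
  (fun i => M' i (s i)) (index_enum_uniq _) (fun i => dM i (s i)).
by apply: is_derive_eq (is_deriveZ ((-1) ^+ s) ds) _.
Qed.

Lemma differentiable_mx m n (M : V -> 'M[R]_(m, n)) x :
  (forall i j, differentiable (fun y => M y i j) x) -> differentiable M x.
Proof.
move=> dM.
have -> : M = \sum_(i < m) \sum_(j < n) (fun y => M y i j *: delta_mx i j).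
  apply/funext => y; rewrite fct_sumE [LHS]matrix_sum_delta.
  by apply: eq_bigr => i _; rewrite fct_sumE.
apply: differentiable_sum => i; apply: differentiable_sum => j.
exact: differentiableZl.
Qed.

Lemma is_derive_comp (W W' : normedModType R) (f : W -> W') (h : V -> W) x u :
  differentiable h x -> differentiable f (h x) ->
  is_derive x u (fun y => f (h y)) ('D_('D_u h x) f (h x)).
Proof.
move=> dh df; rewrite -/(f \o h); apply: DeriveDef.
  exact/diff_derivable/differentiable_comp.
rewrite deriveE; last exact: differentiable_comp.
by rewrite diff_comp//= [in RHS]deriveE// [in RHS]deriveE.
Qed.

Lemma is_derive_expR_comp (f : V -> R) x u (f' : R) :
  differentiable f x -> is_derive x u f f' ->
  is_derive x u (fun y => expR (f y)) (expR (f x) * f').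
Proof.
move=> df [_ f'E].
have dexp : differentiable (@expR R) (f x).
  exact/derivable1_diffP/derivable_expR.
apply: is_derive_eq (is_derive_comp u df dexp) _.
rewrite f'E deriveE// -[X in 'd _ _ X]mulr1 linearZ/= -deriveE//.
by rewrite derive_val mulrC.
Qed.

End matrix_derivatives.

(** * Smooth functions, symmetry of mixed derivatives, gradients and Hessians *)

Section smooth_functions.
Context (R : realType) (d : nat).
Implicit Types (f h : 'rV[R]_d -> R) (x u v : 'rV[R]_d).

Lemma smooth_differentiable f x : smooth f -> differentiable f x.
Proof. by move=> /(_ [::] x). Qed.

Lemma smooth_partial i f : smooth f -> smooth (partial i f).
Proof. by move=> sf s x; rewrite -foldr_rcons; exact: sf. Qed.

Lemma smooth_cst (c : R) : smooth (cst c : 'rV[R]_d -> R).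
Proof.
have part0 i (a : R) : partial i (cst a : 'rV[R]_d -> R) = cst 0.
  by apply/funext => x; rewrite /partial derive_cst.
have foldr_cst s : exists a : R, foldr (@partial R d) (cst c) s = cst a.
  elim: s => [|i s [a IH]] /=; first by exists c.
  by exists 0; rewrite IH part0.
by move=> s x; have [a ->] := foldr_cst s.
Qed.

Lemma smoothD f h : smooth f -> smooth h -> smooth (f + h).
Proof.
move=> sf sh.
have foldrD s : foldr (@partial R d) (f + h) s =
    foldr (@partial R d) f s + foldr (@partial R d) h s.
  elim: s => // i s /= ->; apply/funext => x.
  by rewrite /partial deriveD//; apply: diff_derivable; [exact: sf|exact: sh].
by move=> s x; rewrite foldrD; apply: differentiableD; [exact: sf|exact: sh].
Qed.

Lemma smoothZ (c : R) f : smooth f -> smooth (c *: f).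
Proof.
move=> sf.
have foldrZ s : foldr (@partial R d) (c *: f) s = c *: foldr (@partial R d) f s.
  elim: s => // i s /= ->; apply/funext => x.
  by rewrite /partial deriveZ//; apply: diff_derivable; exact: sf.
by move=> s x; rewrite foldrZ; apply: differentiableZ; exact: sf.
Qed.

Lemma derive_partial f x u : differentiable f x ->
  'D_u f x = \sum_i u ord0 i * partial i f x.
Proof.
move=> df; rewrite deriveE// [in LHS](row_sum_delta u) linear_sum/=.
by apply: eq_bigr => i _; rewrite linearZ/= /partial deriveE.
Qed.

(** By differentiability, ['D_u f] is a linear combination of partial derivatives with constant
    coefficients. *)
Lemma smooth_derive f u : smooth f -> smooth ('D_u f).
Proof.
move=> sf.
have -> : 'D_u f = \sum_i u ord0 i *: partial i f.
  apply/funext => x; rewrite fct_sumE derive_partial//.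
  exact: smooth_differentiable.
elim/big_ind : _ => [|*|i _]; first exact: smooth_cst.
  exact: smoothD.
exact/smoothZ/smooth_partial.
Qed.

Lemma is_derive_line f x u (t : R) : differentiable f (x + t *: u) ->
  is_derive t 1 (fun s : R => f (x + s *: u)) ('D_u f (x + t *: u)).
Proof.
move=> df.
have dl : is_diff t (fun s : R => x + s *: u) ( *:%R^~ u).
  have := is_diffD (is_diff_cst x t) (is_diff_scalel t u).
  by rewrite add0r.
have dl' : differentiable (fun s : R => x + s *: u) t by exact: ex_diff.
apply: is_derive_eq (is_derive_comp (1 : R^o) dl' df) _.
by rewrite (deriveE _ dl') diff_val scale1r.
Qed.

Lemma MVT_line f x u (s : R) : (forall y, differentiable f y) -> 0 < s ->
  exists2 t, t \in `]0, s[%R & f (x + s *: u) - f x = s * 'D_u f (x + t *: u).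
Proof.
move=> df s0.
have dl (t : R) : is_derive t 1 (fun s : R => f (x + s *: u))
    ('D_u f (x + t *: u)).
  exact: is_derive_line.
have [|t tI] := @MVT R (fun s : R => f (x + s *: u))
  (fun t => 'D_u f (x + t *: u)) 0 s s0 (fun t _ => dl t).
  apply: continuous_subspaceT => t.
  apply/differentiable_continuous/derivable1_diffP.
  by have [] := dl t.
by rewrite scale0r addr0 subr0 mulrC => ->; exists t.
Qed.

(* The second difference of f on the parallelogram with sides s u and s v
   does not see the order of u and v. *)
Lemma second_difference f x u v (s : R) : smooth f -> 0 < s ->
  exists t r, [/\ t \in `]0, s[%R, r \in `]0, s[%R &
    f (x + s *: u + s *: v) - f (x + s *: u) - (f (x + s *: v) - f x) =
    s ^+ 2 * 'D_v ('D_u f) (x + t *: u + r *: v)].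
Proof.
move=> sf s0.
(* The second difference is the increment of [h] along [s *: u]. The mean value theorem for [h] in
   direction [u] produces [t]; applied next to ['D_u f] in direction [v] it produces [r]. *)
pose h y := f (y + s *: v) - f y.
have dsh y w : differentiable (fun z => f (z + w)) y.
  apply: differentiable_comp; last exact: (smooth_differentiable _ sf).
  exact: differentiableD.
have dh y : differentiable h y.
  by apply: differentiableB => //; exact: smooth_differentiable.
have [t tI ht] := MVT_line x u dh s0.
have Dh : 'D_u h (x + t *: u) =
    'D_u f (x + t *: u + s *: v) - 'D_u f (x + t *: u).
  rewrite deriveB; last 2 first.
  - exact: diff_derivable.
  - by apply: diff_derivable; exact: smooth_differentiable.
  (* Translation commutes with differentiation: the two difference quotients agree up to the order
     of summation. *)
  congr (_ - _); rewrite /derive; set F := (X in lim (X @ _)).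
  set F' := (X in _ = lim (X @ _)); suff -> : F = F' by [].
  by apply/funext => e; rewrite /F /F' /= !addrA.
have [|r rI hr] := @MVT_line ('D_u f) (x + t *: u) v s _ s0.
  by move=> y; exact: (smooth_differentiable y (smooth_derive u sf)).
exists t, r; split => //.
by move: ht; rewrite /h => ->; rewrite Dh hr mulrA.
Qed.

(** Schwarz's theorem. One second difference equals [s ^+ 2] times either mixed derivative, each
    taken at some point near [x]; continuity of both at [x] then makes their gap smaller than any
    [e]. *)
Lemma smooth_deriveC f x u v : smooth f ->
  'D_v ('D_u f) x = 'D_u ('D_v f) x.
Proof.
move=> sf; apply/eqP; rewrite -subr_eq0 -normr_le0; apply/ler_addgt0Pl => e e0.
have cont a b : {for x, continuous ('D_b ('D_a f))}.
  apply: differentiable_continuous.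
  exact: (smooth_differentiable x (smooth_derive b (smooth_derive a sf))).
have e20 : 0 < e / 2 by rewrite divr_gt0.
have /nbhs_normP[r1 /= r10 H1] : \forall y \near x,
    `|'D_v ('D_u f) x - 'D_v ('D_u f) y| < e / 2.
  by have /cvgrPdist_lt := cont u v; apply.
have /nbhs_normP[r2 /= r20 H2] : \forall y \near x,
    `|'D_u ('D_v f) x - 'D_u ('D_v f) y| < e / 2.
  by have /cvgrPdist_lt := cont v u; apply.
pose r := Num.min r1 r2; have r0 : 0 < r by rewrite lt_min r10.
(* With step [s = r / n] the whole parallelogram stays within distance [r] of [x]. The added 1 keeps
   [n] positive when [u] and [v] vanish. *)
pose n := `|u| + `|v| + 1.
have n0 : 0 < n by rewrite ltr_wpDl// addr_ge0.
pose s := r / n; have s0 : 0 < s by rewrite divr_gt0.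
have near_x (a b : R) : a \in `]0, s[%R -> b \in `]0, s[%R ->
    `|x - (x + a *: u + b *: v)| < r.
  rewrite !in_itv/= => /andP[a0 as_] /andP[b0 bs].
  rewrite -addrA opprD addNKr normrN.
  apply: le_lt_trans (ler_normD _ _) _.
  rewrite !normrZ !gtr0_norm//.
  apply: (@le_lt_trans _ _ (s * (`|u| + `|v|))).
    by rewrite mulrDr lerD// ler_wpM2r// ltW.
  by rewrite /s -mulrA gtr_pMr// mulrC ltr_pdivrMr// mul1r ltrDl.
have [a [b [aI bI Eab]]] := second_difference x u v sf s0.
have [b' [a' [bI' aI' Eab']]] := second_difference x v u sf s0.
have Eq : 'D_v ('D_u f) (x + a *: u + b *: v) =
    'D_u ('D_v f) (x + b' *: v + a' *: u).
  apply: (@mulfI _ (s ^+ 2)); first by rewrite expf_neq0// gt_eqF.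
  apply: (etrans (esym Eab)); apply: (etrans _ Eab').
  rewrite (addrAC x (s *: u)).
  move: (f (_ + _ + _)) (f (x + s *: u)) (f (x + s *: v)) (f x) => p q p' q'.
  by ring.
rewrite addr0 -(subrKA ('D_v ('D_u f) (x + a *: u + b *: v))).
apply: le_trans (ler_normD _ _) _.
rewrite (splitr e); apply: lerD; apply: ltW.
  by apply: H1; apply: lt_le_trans (near_x _ _ aI bI) _;
    rewrite ge_min lexx.
rewrite Eq distrC; apply: H2.
rewrite (addrAC x).
by apply: lt_le_trans (near_x _ _ aI' bI') _; rewrite ge_min lexx orbT.
Qed.

Lemma partialC f i j : smooth f ->
  partial i (partial j f) = partial j (partial i f).
Proof. by move=> sf; apply/funext => x; exact: smooth_deriveC. Qed.

Lemma derive_gradient f x u : smooth f ->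
  is_derive x u (gradient f) (u *m hessian f x).
Proof.
move=> sf; apply/is_derive_mxP => i j.
rewrite (ord1 i).
have -> : (fun y => gradient f y ord0 j) = partial j f.
  by apply/funext => y; rewrite mxE.
have df := smooth_differentiable x (smooth_partial j sf).
apply: is_derive_eq (derivableP (diff_derivable df)) _.
rewrite derive_partial// mxE.
by apply: eq_bigr => k _; rewrite mxE.
Qed.

Lemma differentiable_gradient f x : smooth f -> differentiable (gradient f) x.
Proof.
move=> sf; apply: differentiable_mx => i j.
have -> : (fun y => gradient f y i j) = partial j f.
  by apply/funext => y; rewrite mxE.
exact/smooth_differentiable/smooth_partial.
Qed.

Lemma hessian_sym f x : smooth f -> (hessian f x)^T = hessian f x.
Proof. by move=> sf; apply/matrixP => i j; rewrite !mxE partialC. Qed.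

Lemma differentiable_hessian f x : smooth f -> differentiable (hessian f) x.
Proof.
move=> sf; apply: differentiable_mx => i j.
have -> : (fun y => hessian f y i j) = partial i (partial j f).
  by apply/funext => y; rewrite mxE.
exact/smooth_differentiable/smooth_partial/smooth_partial.
Qed.

Lemma dotp_gradient f x u : differentiable f x ->
  dotp u (gradient f x) = 'D_u f x.
Proof.
move=> df; rewrite derive_partial// /dotp mxE.
by apply: eq_bigr => i _; rewrite !mxE.
Qed.

Lemma derive_hessian f x u : smooth f ->
  'D_u (hessian f) x = \matrix_(i, j) 'D_u (partial i (partial j f)) x.
Proof.
move=> sf; rewrite derive_mx; last first.
  exact/diff_derivable/differentiable_hessian.
apply: eq_mx => i j.
have -> // : (fun y => hessian f y i j) = partial i (partial j f).
by apply/funext => y; rewrite mxE.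
Qed.

Lemma derive_hessian_sym f x u : smooth f ->
  ('D_u (hessian f) x)^T = 'D_u (hessian f) x.
Proof.
move=> sf; rewrite derive_hessian//; apply/matrixP => i j.
by rewrite mxE mxE [RHS]mxE partialC.
Qed.

(** Symmetry of third derivatives: entry [j] of either side is a mixed derivative of [partial j f]
    along [u] and [v]. *)
Lemma derive_hessian_swap f x u v : smooth f ->
  v *m 'D_u (hessian f) x = u *m 'D_v (hessian f) x.
Proof.
move=> sf.
have third a b : b *m 'D_a (hessian f) x =
    \row_j 'D_a ('D_b (partial j f)) x.
  rewrite derive_hessian//; apply/rowP => j; rewrite mxE [RHS]mxE.
  under eq_bigr do rewrite mxE.
  have -> : 'D_b (partial j f) = fun y =>
      \sum_i b ord0 i * partial i (partial j f) y.
    apply/funext => y; rewrite derive_partial//.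
    exact/smooth_differentiable/smooth_partial.
  apply/esym/(@derive_val _ _ _ _ _ _ _ (is_derive_sumf _)) => i.
  apply: is_deriveZ; apply/derivableP/diff_derivable/smooth_differentiable.
  exact/smooth_partial/smooth_partial.
rewrite (third u v) (third v u); apply: eq_mx => _ j.
exact: (smooth_deriveC x v u (smooth_partial j sf)).
Qed.

Lemma derive_hessian_derivable f x u v : smooth f ->
  derivable ('D_u (hessian f)) x v.
Proof.
move=> sf; apply/derivable_mxP => i j.
have -> : (fun y => 'D_u (hessian f) y i j) = 'D_u (partial i (partial j f)).
  by apply/funext => y; rewrite derive_hessian// mxE.
apply/diff_derivable/smooth_differentiable.
exact/smooth_derive/smooth_partial/smooth_partial.
Qed.

Lemma derive2_hessianC f x u v : smooth f ->
  'D_v ('D_u (hessian f)) x = 'D_u ('D_v (hessian f)) x.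
Proof.
move=> sf.
have dd a b : 'D_b ('D_a (hessian f)) x =
    \matrix_(i, j) 'D_b ('D_a (partial i (partial j f))) x.
  rewrite derive_mx; last exact: derive_hessian_derivable.
  apply: eq_mx => i j.
  have -> // : (fun y => 'D_a (hessian f) y i j) =
    'D_a (partial i (partial j f)).
  by apply/funext => y; rewrite derive_hessian// mxE.
apply: etrans (dd u v) (etrans _ (esym (dd v u))); apply: eq_mx => i j.
exact: (smooth_deriveC x u v (smooth_partial i (smooth_partial j sf))).
Qed.

End smooth_functions.

(** * The dot product, Cholesky factorization and positivity of a trace *)

Section positive_matrices.
Context (R : realType).

Lemma dotpE n (u v : 'rV[R]_n) : dotp u v = \sum_i u ord0 i * v ord0 i.
Proof. by rewrite /dotp mxE; apply: eq_bigr => i _; rewrite mxE. Qed.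

Lemma dotpC n (u v : 'rV[R]_n) : dotp u v = dotp v u.
Proof. by rewrite !dotpE; apply: eq_bigr => i _; rewrite mulrC. Qed.

Lemma dotpDl n (u v w : 'rV[R]_n) : dotp (u + v) w = dotp u w + dotp v w.
Proof. by rewrite /dotp mulmxDl mxE. Qed.

Lemma dotpNl n (u w : 'rV[R]_n) : dotp (- u) w = - dotp u w.
Proof. by rewrite /dotp mulNmx mxE. Qed.

Lemma dotpZl n (a : R) (u w : 'rV[R]_n) : dotp (a *: u) w = a * dotp u w.
Proof. by rewrite /dotp -scalemxAl mxE. Qed.

Lemma dotp_mulmx n (u v : 'rV[R]_n) (A : 'M[R]_n) :
  dotp (u *m A) v = dotp u (v *m A^T).
Proof. by rewrite /dotp trmx_mul trmxK mulmxA. Qed.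

(* Each step takes the square root of the corner entry and recurses on its
   Schur complement. *)
Lemma posdef_cholesky n (A : 'M[R]_n) : A^T = A -> posdef A ->
  exists L : 'M[R]_n, A = L^T *m L.
Proof.
elim: n A => [|n IH] A; first by exists 0; apply/matrixP => -[].
rewrite -[n.+1]/(1 + n)%N in A * => symA posA.
pose a := A 0 0; pose b := ursubmx A; pose C := drsubmx A.
have Aul : ulsubmx A = a%:M.
  by rewrite [LHS]mx11_scalar !mxE; congr ((A _ _)%:M); apply: val_inj.
have Adl : dlsubmx A = b^T by rewrite /b trmx_ursub symA.
have symC : C^T = C by rewrite /C trmx_drsub symA.
have Ablock : A = block_mx a%:M b b^T C by rewrite -Aul -Adl submxK.
have form x (e : 'rV[R]_n) : dotp (row_mx x e *m A) (row_mx x e) =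
    dotp (x *m a%:M + e *m b^T) x + dotp (x *m b + e *m C) e.
  by rewrite /dotp Ablock mul_row_block tr_row_mx mul_row_col mxE.
have a0 : 0 < a.
  (* The quadratic form at the first basis vector is the corner entry. *)
  have := posA (row_mx 1%:M 0); rewrite form !mul0mx !addr0 mul1mx.
  rewrite {2}/dotp trmx0 mulmx0 /dotp trmx1 mulmx1 !mxE eqxx addr0 mulr1n.
  apply; apply/eqP => /(congr1 lsubmx)/matrixP/(_ 0 0).
  by rewrite row_mxKl linear0 !mxE eqxx => /eqP; rewrite oner_eq0.
have an0 : a != 0 by rewrite gt_eqF.
pose S := C - a^-1 *: (b^T *m b).
have symS : S^T = S.
  by rewrite /S linearB/= linearZ/= trmx_mul trmxK symC.
have posS : posdef S.
  (* Completing the square: this [x] minimizes the form of [A] at [(x, e)] for given [e], and the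
     minimum is the form of [S] at [e]. *)
  move=> e e0; pose x := - a^-1 *: (e *m b^T).
  have := posA (row_mx x e); rewrite form.
  have -> : x *m a%:M + e *m b^T = 0.
    by rewrite mul_mx_scalar scalerA mulrN mulfV// scaleN1r addNr.
  have -> : x *m b + e *m C = e *m S.
    rewrite /S mulmxBr -scalemxAr /x -scalemxAl scaleNr mulmxA addrC.
    by [].
  rewrite {1}/dotp mul0mx mxE add0r; apply.
  by apply: contra_neq e0 => /(congr1 rsubmx); rewrite row_mxKr linear0.
have [L SL] := IH S symS posS.
pose s := Num.sqrt a.
have ss : s * s = a by rewrite -expr2 sqr_sqrtr// ltW.
have s0 : s != 0 by rewrite gt_eqF// sqrtr_gt0.
exists (block_mx s%:M (s^-1 *: b) 0 L).
rewrite [LHS]Ablock tr_block_mx mulmx_block !trmx0 !mul0mx !mulmx0 !addr0.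
rewrite tr_scalar_mx -scalar_mxM ss mul_scalar_mx scalerA mulfV// scale1r.
rewrite linearZ/= mul_mx_scalar scalerA mulfV// scale1r -SL /S.
rewrite -scalemxAl -scalemxAr scalerA -invfM ss.
by rewrite addrC subrK.
Qed.

Lemma mxtrace_mul_tr_ge0 n (N : 'M[R]_n) : 0 <= \tr (N *m N^T).
Proof.
rewrite /mxtrace sumr_ge0// => i _; rewrite mxE sumr_ge0// => j _.
by rewrite mxE -expr2 sqr_ge0.
Qed.

(** With [G = L^T *m L], the matrix [A *m invmx G] is similar to the symmetric matrix
    [N = L^-T A L^-1], so the trace of its square is the squared Frobenius norm of [N]. *)
Lemma mxtrace_sqr_ge0 n (G A : 'M[R]_n) :
  G \in unitmx -> G^T = G -> posdef G -> A^T = A ->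
  0 <= \tr ((A *m invmx G) *m (A *m invmx G)).
Proof.
move=> uG symG posG symA; have [L GL] := posdef_cholesky symG posG.
have uL : L \in unitmx.
  by move: uG; rewrite GL unitmx_mul unitmx_tr andbb.
pose K := invmx L; pose N := K^T *m A *m K.
have -> : invmx G = K *m K^T.
  have GK : G *m (K *m K^T) = 1%:M.
    rewrite GL -mulmxA (mulmxA L) mulmxV// mul1mx.
    by rewrite -trmx_mul mulVmx// trmx1.
  by rewrite -[LHS]mulmx1 -GK mulKmx.
have -> : \tr (A *m (K *m K^T) *m (A *m (K *m K^T))) = \tr (N *m N^T).
  rewrite /N !trmx_mul trmxK symA !mulmxA mxtrace_mulC.
  by rewrite !mulmxA.
exact: mxtrace_mul_tr_ge0.
Qed.

End positive_matrices.

(** * First- and second-order consequences of convexity *)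

Section convexity.
Context (R : realType) (d : nat).
Implicit Types (f : 'rV[R]_d -> R) (x u : 'rV[R]_d).

(** The derivative is also the limit of difference quotients from the right, and these are at least
    [c] for small positive [t]. *)
Lemma derive_ge f x u (c : R) : derivable f x u ->
  (forall t : R, 0 < t -> t < 1 -> t * c <= f (t *: u + x) - f x) ->
  c <= 'D_u f x.
Proof.
move=> df fc; have := cvg_dnbhs_at_right df; move=> /cvgr_to_ge; apply.
near=> t.
have t0 : 0 < t by near: t; exact: nbhs_right_gt.
have t1 : t < 1 by near: t; exact: nbhs_right_lt.
by rewrite /= /GRing.scale/= ler_pdivlMl//; exact: fc.
Unshelve. all: by end_near. Qed.

(** The graph lies above its tangents. Convexity on the segment bounds the increments of [- f] from
    below, as [derive_ge] requires. *)
Lemma convex_tangent f x y : convex f -> differentiable f x ->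
  'D_(y - x) f x <= f y - f x.
Proof.
move=> cf df; rewrite -lerN2 -deriveN; last exact: diff_derivable.
apply: derive_ge => [|t t0 t1]; first exact/derivableN/diff_derivable.
pose s := Itv01 (ltW t0) (ltW t1).
have := cf s y x; rewrite !in_setT => /(_ isT isT).
rewrite [leRHS]convRE /conv/= /unstable.onem.
have -> : t *: y + (1 - t) *: x = t *: (y - x) + x.
  by rewrite scalerBl scale1r scalerBr addrA addrAC.
move=> fle; rewrite -[(- f) _]/(- f _) -[(- f) x]/(- f x).
by move: fle; move: (f (t *: (y - x) + x)) (f x) (f y) => p q r; lra.
Qed.

Lemma derive_scaled f x u (a : R) : differentiable f x ->
  'D_(a *: u) f x = a * 'D_u f x.
Proof.
by move=> df; rewrite (deriveE _ df) linearZ/= -(deriveE _ df).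
Qed.

(** Adding the tangent inequalities at [x] and at [t *: u + x], and dividing by [t], shows that
    ['D_u f] does not decrease along [u]. *)
Lemma convex_derive2_ge0 f x u : smooth f -> convex f -> 0 <= 'D_u ('D_u f) x.
Proof.
move=> sf cf; have df y : differentiable f y := smooth_differentiable y sf.
apply: derive_ge => [|t t0 t1].
  exact: (diff_derivable (smooth_differentiable x (smooth_derive u sf))).
rewrite mulr0 subr_ge0.
have := convex_tangent (t *: u + x) cf (df x).
rewrite addrK (derive_scaled _ t (df x)) => le1.
have := convex_tangent x cf (df (t *: u + x)).
rewrite opprD addrCA subrr addr0 -scaleNr.
rewrite (derive_scaled _ (- t) (df _)) => le2; rewrite -(ler_pM2l t0).
move: le1 le2.
move: (f _) (f x) ('D_u f x) ('D_u f _) => p q p' q'; lra.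
Qed.

Lemma convex_hessian_ge0 f x u : smooth f -> convex f ->
  0 <= dotp (u *m hessian f x) u.
Proof.
move=> sf cf; have := convex_derive2_ge0 x u sf cf.
suff -> : 'D_u ('D_u f) x = dotp (u *m hessian f x) u by [].
have -> : 'D_u f = fun y => \sum_i partial i f y * u ord0 i.
  apply/funext => y; rewrite derive_partial; last exact: smooth_differentiable.
  by apply: eq_bigr => i _; rewrite mulrC.
have di i : is_derive x u (partial i f) ((u *m hessian f x) ord0 i).
  have /is_derive_mxP/(_ ord0 i) := derive_gradient x u sf.
  by have -> // : (fun y => gradient f y ord0 i) = partial i f;
    apply/funext => y; rewrite mxE.
rewrite dotpE.
have ds : is_derive x u (fun y => \sum_i partial i f y * u ord0 i)
    (\sum_i (u *m hessian f x) ord0 i * u ord0 i).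
  apply: is_derive_sumf => i.
  have := is_deriveM (di i) (is_derive_cst (u ord0 i : R) x u).
  rewrite scaler0 add0r => H.
  by apply: is_derive_eq H _; rewrite /GRing.scale/= mulrC.
by case: ds.
Qed.

End convexity.

(** * Derivative of the inverse matrix, and the Riemannian geometry of a Hessian metric *)

Lemma is_derive_invmx (R : realType) (V : normedModType R) n
    (M : V -> 'M[R]_n) x u (M' : 'M[R]_n) :
  (forall y, M y \in unitmx) -> derivable (fun y => invmx (M y)) x u ->
  is_derive x u M M' ->
  is_derive x u (fun y => invmx (M y)) (- (invmx (M x) *m M' *m invmx (M x))).
Proof.
move=> uM /derivableP dN dM; set N' := 'D_u _ x in dN.
apply: (is_derive_eq dN).
(* The constant product of the inverse with [M] has derivative zero, and this equation is solved for
   [N']. *)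
have := is_derive_mulmx dN dM.
have -> : (fun y => invmx (M y) *m M y) = cst 1%:M.
  by apply/funext => y; rewrite mulVmx.
case=> _; rewrite derive_cst => /esym/eqP; rewrite addr_eq0 => /eqP N'M.
by rewrite -[LHS](mulmxK (uM x)) N'M mulNmx.
Qed.

Section hessian_metrics.
Context (R : realType) (d : nat) (Phi : 'rV[R]_d -> R).
Local Notation G := (hessian Phi).
Context (Phi_smooth : smooth Phi) (G_unit : forall x, G x \in unitmx).
Context (G_inv_differentiable :
  forall x, differentiable (fun y => invmx (G y)) x).
Implicit Types (x u v : 'rV[R]_d).

(* The connection matrix of the Levi-Civita connection: nabla_u v = v B(u)
   for constant fields u, v. *)
Definition connection_mx u x : 'M[R]_d :=
  2^-1 *: ('D_u G x *m invmx (G x)).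

Lemma invmx_hessian_sym x : (invmx (G x))^T = invmx (G x).
Proof. by rewrite trmx_inv hessian_sym. Qed.

(** For a Hessian metric the three terms of the Christoffel symbol are one and the same third
    derivative of [Phi], so two of them cancel. *)
Lemma christoffel_hessian k i j x : christoffel G k i j x =
  2^-1 * \sum_l invmx (G x) k l * partial i (partial j (partial l Phi)) x.
Proof.
have GE a b : (fun y => G y a b) = partial a (partial b Phi).
  by apply/funext => y; rewrite mxE.
rewrite /christoffel; congr (_ * _); apply: eq_bigr => l _; congr (_ * _).
rewrite !GE (partialC j i (smooth_partial l Phi_smooth)).
rewrite (partialC i j Phi_smooth) (partialC l j (smooth_partial i Phi_smooth)).
rewrite (partialC l i Phi_smooth) (partialC j i (smooth_partial l Phi_smooth)).
by rewrite addrK.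
Qed.

Lemma derive_hessianE u x i j : ('D_u G x) i j =
  \sum_k u ord0 k * partial k (partial i (partial j Phi)) x.
Proof.
rewrite (derive_hessian x u Phi_smooth) mxE derive_partial//.
have sp := smooth_partial i (smooth_partial j Phi_smooth).
exact: (smooth_differentiable x sp).
Qed.

Lemma covariant_derivative_hessian (X Z : 'rV[R]_d -> 'rV[R]_d) x :
  covariant_derivative G X Z x = 'D_(X x) Z x + Z x *m connection_mx (X x) x.
Proof.
rewrite /covariant_derivative; congr (_ + _); apply/rowP => k.
rewrite /connection_mx -scalemxAr mxE [RHS]mxE mulmxA mxE mulr_sumr.
under eq_bigr => i _.
  under eq_bigr => j _ do rewrite christoffel_hessian.
  over.
have AE l : (Z x *m 'D_(X x) G x) 0 l = \sum_i \sum_j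
    X x ord0 i * Z x ord0 j * partial i (partial j (partial l Phi)) x.
  rewrite mxE exchange_big/=; apply: eq_bigr => j _.
  rewrite derive_hessianE mulr_sumr; apply: eq_bigr => i _.
  by rewrite mulrA (mulrC (X x _ _)).
(* Both sides become one triple sum; the Christoffel symbol has the inverse metric at [(k, l)], the
   matrix product at [(l, k)], hence the appeal to its symmetry at the end. *)
transitivity (\sum_i \sum_j \sum_l 2^-1 * (invmx (G x) k l *
   (X x ord0 i * Z x ord0 j * partial i (partial j (partial l Phi)) x))).
  apply: eq_bigr => i _; apply: eq_bigr => j _.
  rewrite mulr_sumr !mulr_suml; apply: eq_bigr => l _.
  by rewrite -!mulrA; congr (_ * (_ * _)); rewrite mulrC -mulrA.
under eq_bigr => i _ do rewrite exchange_big/=.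
rewrite exchange_big/=; apply: eq_bigr => l _.
rewrite AE mulr_suml mulr_sumr; apply: eq_bigr => i _.
rewrite mulr_suml mulr_sumr; apply: eq_bigr => j _.
congr (_ * _); rewrite mulrC; congr (_ * _).
by rewrite -[in LHS]invmx_hessian_sym mxE.
Qed.

Lemma connection_mx0 x : connection_mx 0 x = 0.
Proof. by rewrite /connection_mx derive0 mul0mx scaler0. Qed.

(** Torsion-freeness of the connection, read on constant fields. *)
Lemma connection_mx_swap u v x :
  v *m connection_mx u x = u *m connection_mx v x.
Proof.
rewrite /connection_mx -!scalemxAr !mulmxA.
by rewrite (derive_hessian_swap x u v Phi_smooth).
Qed.

(** The factor 2 arises because differentiating the inverse metric yields one factor 1/2, while the
    product of two connection matrices carries 1/4. *)
Lemma derive_connection_mx u v x :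
  is_derive x v (connection_mx u)
    (2^-1 *: ('D_v ('D_u G) x *m invmx (G x))
     - 2 *: (connection_mx u x *m connection_mx v x)).
Proof.
have dG : is_derive x v G ('D_v G x).
  exact/derivableP/diff_derivable/differentiable_hessian.
have dH := is_derive_invmx G_unit (diff_derivable (G_inv_differentiable x)) dG.
have dA : is_derive x v ('D_u G) ('D_v ('D_u G) x).
  by apply: derivableP; exact: derive_hessian_derivable.
apply: is_derive_eq (is_deriveZ 2^-1 (is_derive_mulmx dA dH)) _.
have alg (A B C H : 'M[R]_d) : 2^-1 *: (C *m H + A *m - (H *m B *m H)) =
    2^-1 *: (C *m H) - 2 *: ((2^-1 *: (A *m H)) *m (2^-1 *: (B *m H))).
  rewrite scalerDr mulmxN scalerN -scalemxAl -scalemxAr !scalerA.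
  by rewrite mulfV ?pnatr_eq0// mul1r !mulmxA.
exact: (alg ('D_u G x) ('D_v G x) ('D_v ('D_u G) x) (invmx (G x))).
Qed.

Lemma curvature_hessian u v w x :
  curvature G (cst u) (cst v) (cst w) x =
  w *m (connection_mx u x *m connection_mx v x
        - connection_mx v x *m connection_mx u x).
Proof.
have cov_cst a : covariant_derivative G (cst a) (cst w) =
    fun y => w *m connection_mx a y.
  apply/funext => y.
  by rewrite covariant_derivative_hessian/= derive_cst add0r.
(* The outer covariant derivative adds [B(a) B(b)] to the [- 2 B(a) B(b)] coming from the derivative
   of [B(a)], so one negative copy remains. *)
have cov2 a b : covariant_derivative G (cst b)
    (covariant_derivative G (cst a) (cst w)) x =
    w *m (2^-1 *: ('D_b ('D_a G) x *m invmx (G x))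
     - connection_mx a x *m connection_mx b x).
  rewrite cov_cst covariant_derivative_hessian/=.
  have [_ ->] := is_derive_mulmx (is_derive_cst w x b)
    (derive_connection_mx a b x).
  rewrite mul0mx add0r -mulmxA -mulmxDr; congr (_ *m _).
  by rewrite -addrA; congr (_ + _); rewrite scaler_nat mulr2n opprD addrNK.
have cov3 : covariant_derivative G (lie_bracket (cst u) (cst v)) (cst w) x = 0.
  have lie0 : lie_bracket (cst u) (cst v) x = 0.
    apply/eqP; rewrite subr_eq0; apply/eqP.
    exact: etrans (derive_cst _ _ _) (esym (derive_cst _ _ _)).
  rewrite covariant_derivative_hessian lie0 derive0 connection_mx0.
  by rewrite mulmx0 addr0.
rewrite /curvature (cov2 v u) (cov2 u v) cov3 subr0.
(* [C] and [C'] are the second derivatives of the metric in the two orders; they agree, so the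
   fourth derivatives of [Phi] drop out. *)
have alg (C C' A B : 'M[R]_d) : C' = C ->
    w *m (2^-1 *: (C *m invmx (G x)) - A) -
    w *m (2^-1 *: (C' *m invmx (G x)) - B) =
    w *m (B - A).
  by move=> ->; rewrite -mulmxBr opprB addrC addrA addrNK.
exact/alg/derive2_hessianC.
Qed.

(** Swapping arguments of the connection turns [u B(e_i)] into [e_i B(u)] and [u B(u) B(e_i)] into
    [e_i B(u B(u))]; the sum over [i] then runs over diagonal entries. *)
Lemma ricci_hessian u x : ricci G x u u =
  \tr (connection_mx u x *m connection_mx u x)
  - \tr (connection_mx (u *m connection_mx u x) x).
Proof.
rewrite /ricci /mxtrace -sumrB; apply: eq_bigr => i _.
rewrite curvature_hessian.
have := connection_mx_swap (delta_mx ord0 i) u x.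
have := connection_mx_swap (delta_mx ord0 i) (u *m connection_mx u x) x.
move: (connection_mx (u *m connection_mx u x) x) => Beta.
move: (connection_mx u x) (connection_mx (delta_mx ord0 i) x).
move=> Bu Bi s2 s1; rewrite mulmxBr !mulmxA s1 s2 -mulmxA -!rowE.
by rewrite !mxE.
Qed.

(** After multiplication by the metric, differentiating its inverse contributes [- p H A] and the
    connection contributes half of [p H A]; the remaining half pairs with [u] as [p] does with
    [u B(u)]. *)
Lemma riem_hessian_hessian (P : 'rV[R]_d -> R) u x (p' : 'rV[R]_d) :
  is_derive x u (gradient P) p' ->
  riem_hessian G P x u u =
  dotp p' u - dotp (gradient P x) (u *m connection_mx u x).
Proof.
move=> dp.
have dG : is_derive x u G ('D_u G x).
  exact/derivableP/diff_derivable/differentiable_hessian.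
have dH := is_derive_invmx G_unit (diff_derivable (G_inv_differentiable x)) dG.
rewrite /riem_hessian /inner covariant_derivative_hessian/=.
have [_ ->] := is_derive_mulmx dp dH.
set A := 'D_u G x; set H := invmx (G x); set p := gradient P x.
have symA : A^T = A by exact: derive_hessian_sym.
have -> : (p' *m H + p *m - (H *m A *m H) + riem_gradient G P x *m
    connection_mx u x) *m G x = p' - 2^-1 *: (p *m (H *m A)).
  rewrite /connection_mx -/A -/H /riem_gradient -/p -/H.
  rewrite !mulmxDl mulmxN mulNmx -scalemxAr -scalemxAl !mulmxA.
  rewrite !(mulmxKV (G_unit x)) -addrA; congr (_ + _).
  set q := p *m H *m A; have {1}-> : q = 2^-1 *: q + 2^-1 *: q.
    by rewrite -scalerDl -div1r -splitr scale1r.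
  by rewrite opprD addrNK.
rewrite dotpDl dotpNl; congr (_ - _).
rewrite dotpZl dotp_mulmx trmx_mul symA invmx_hessian_sym.
by rewrite /connection_mx -scalemxAr [RHS]dotpC dotpZl dotpC.
Qed.
End hessian_metrics.

(** * The Monge-Ampere equation and the assembly of the Bakry-Emery inequality *)

Lemma derive_log_det (R : realType) (U : normedModType R) n
    (V w : U -> R) (M : U -> 'M[R]_n) x u (M' : 'M[R]_n) :
  differentiable V x -> differentiable w x -> is_derive x u M M' ->
  M x \in unitmx ->
  (forall y, expR (- V y) = expR (- w y) * \det (M y)) ->
  'D_u V x = 'D_u w x - \tr (M' *m invmx (M x)).
Proof.
move=> dV dw dM uM VwM.
have dexp f : differentiable f x ->
    is_derive x u (fun y => expR (- f y)) (expR (- f x) * - 'D_u f x).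
  move=> df; apply: (is_derive_expR_comp (differentiableN df)).
  exact/is_deriveN/derivableP/diff_derivable.
(* Instead of taking logarithms, the identity itself is differentiated; the nonzero factors
   [expR (- w x)] and [\det (M x)] are cancelled at the end. *)
have [_ DV] := dexp V dV.
have [_ ] := is_deriveM (dexp w dw) (is_derive_det dM).
have -> : (fun y => expR (- w y)) * (fun y => \det (M y)) =
    fun y => expR (- V y) by apply/funext => y; rewrite VwM.
rewrite DV VwM.
have -> : \adj (M x) = \det (M x) *: invmx (M x).
  by rewrite -[LHS](mulmxK uM) mul_adj_mx mul_scalar_mx.
have e0 : expR (- w x) != 0 by rewrite gt_eqF// expR_gt0.
have D0 : \det (M x) != 0 by rewrite -unitfE -unitmxE.
rewrite -scalemxAr mxtraceZ /GRing.scale/=.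
move: (\det _) (expR _) ('D_u V x) ('D_u w x) (\tr _) e0 D0.
move=> D e V' w' t e0 D0 H.
by apply: (mulfI e0); apply: (mulfI D0); move: H; lra.
Qed.

(** The left side is the square root of [expR (- v) * (expR (- w) * D)], which is the square of
    [expR (- v)]. *)
Lemma expR_half_sqrt (R : realType) (v w D : R) :
  expR (- v) = expR (- w) * D ->
  expR (- (2^-1 * (v + w))) * Num.sqrt D = expR (- v).
Proof.
move=> vwD.
have -> : expR (- (2^-1 * (v + w))) = Num.sqrt (expR (- v) * expR (- w)).
  rewrite -[LHS]ger0_norm ?expR_ge0// -sqrtr_sqr expr2 -!expRD.
  by congr (Num.sqrt (expR _)); lra.
rewrite -sqrtrM ?mulr_ge0 ?expR_ge0// -mulrA -vwD -expr2 sqrtr_sqr.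
by rewrite ger0_norm ?expR_ge0.
Qed.

Theorem theorem1p1 (R : realType) (d : nat)
  (V W Phi Psi : 'rV[R]_d -> R) (mu nu : probability 'rV[R]_d R)
  (V_smooth : smooth V) (W_smooth : smooth W)
  (Phi_smooth : smooth Phi) (Psi_smooth : smooth Psi)
  (mu_density : has_density mu (fun x => expR (- V x)))
  (nu_density : has_density nu (fun x => expR (- W x)))
  (Phi_convex : convex Phi)
  (Phi_Psi : is_legendre_transform Phi Psi)
  (Phi_pushforward : forall A : set 'rV[R]_d, measurable A ->
     pushforward mu (gradient Phi) A = nu A)
  (gradK : cancel (gradient Phi) (gradient Psi))
  (gradVK : cancel (gradient Psi) (gradient Phi))
  (hessianK : forall x, hessian Phi x *m hessian Psi (gradient Phi x) = 1%:M)
  (hessian_posdef : forall x, posdef (hessian Phi x))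
  (monge_ampere : forall x,
     expR (- V x) = expR (- W (gradient Phi x)) * \det (hessian Phi x))
  (V_convex : convex V) (W_convex : convex W) :
  let g := hessian Phi in
  let P := fun x => 2^-1 * (V x + W (gradient Phi x)) in
  has_density mu (fun x => expR (- P x) * vol_density g x) /\
  forall x xi : 'rV[R]_d, 0 <= bakry_emery g P x xi xi.
Proof.
move=> g P; split.
  have -> // : (fun x => expR (- P x) * vol_density g x) =
    fun x => expR (- V x).
  by apply/funext => x; exact: expR_half_sqrt.
move=> x xi.
have uG y : g y \in unitmx.
  exact: (proj1 (mulmx1_unit (hessianK y))).
have dT y : differentiable (gradient Phi) y by exact: differentiable_gradient.
(* By duality the inverse metric is the Hessian of [Psi] along [gradient Phi], hence
   differentiable. *)
have dH y : differentiable (fun z => invmx (g z)) y.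
  have -> : (fun z => invmx (g z)) = hessian Psi \o gradient Phi.
    by apply/funext => z; rewrite /= -[LHS]mulmx1 -(hessianK z) mulKmx.
  by apply: differentiable_comp => //; exact: differentiable_hessian.
have dV y : differentiable V y := smooth_differentiable y V_smooth.
have dW y : differentiable W y := smooth_differentiable y W_smooth.
pose w := W \o gradient Phi; pose q := gradient W \o gradient Phi.
have dw y : differentiable w y by exact: differentiable_comp.
have symg y : (g y)^T = g y by exact: hessian_sym.
have Dw y u : 'D_u w y = dotp (u *m g y) (q y).
  have [_ ->] := is_derive_comp u (dT y) (dW (gradient Phi y)).
  have [_ ->] := derive_gradient y u Phi_smooth.
  by rewrite dotp_gradient.
have gradP y : gradient P y = 2^-1 *: (gradient V y + q y *m g y).
  apply/rowP => i; rewrite mxE [RHS]mxE [in RHS]mxE.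
  have dp : is_derive y (delta_mx ord0 i) P
      (2^-1 * (partial i V y + 'D_(delta_mx ord0 i) w y)).
    apply: is_deriveZ; apply: is_deriveD; apply: derivableP;
      exact: diff_derivable.
  have [_] := dp; rewrite /partial => ->; congr (_ * (_ + _)).
    by rewrite mxE.
  rewrite Dw dotpC -[g y in LHS]symg -dotp_mulmx dotpE (bigD1 i)//= big1.
    by rewrite [X in _ * X]mxE !eqxx mulr1 addr0.
  by move=> j ji; rewrite [X in _ * X]mxE (negbTE ji) andbF mulr0.
(* [eta] is the covariant derivative along [xi] of the constant field [xi]. *)
pose A := 'D_xi g x; pose eta := xi *m connection_mx Phi xi x.
have dg : is_derive x xi g A.
  exact/derivableP/diff_derivable/differentiable_hessian.
have dq : is_derive x xi q (xi *m g x *m hessian W (gradient Phi x)).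
  have dGW : differentiable (gradient W) (gradient Phi x).
    exact: differentiable_gradient.
  apply: is_derive_eq (is_derive_comp xi (dT x) dGW) _.
  have [_ ->] := derive_gradient x xi Phi_smooth.
  by have [_ ->] := derive_gradient (gradient Phi x) (xi *m g x) W_smooth.
have dgradP : is_derive x xi (gradient P) (2^-1 *: (xi *m hessian V x +
    (xi *m g x *m hessian W (gradient Phi x) *m g x + q x *m A))).
  have -> : gradient P = 2^-1 \*: (gradient V + (fun y => q y *m g y)).
    by apply/funext => y; rewrite gradP.
  exact: (is_deriveZ _ (is_deriveD (derive_gradient x xi V_smooth)
    (is_derive_mulmx dq dg))).
rewrite /bakry_emery (ricci_hessian Phi_smooth uG dH).
rewrite (riem_hessian_hessian Phi_smooth uG dH dgradP) gradP.
have V2 := convex_hessian_ge0 x xi V_smooth V_convex.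
have W2 := convex_hessian_ge0 (gradient Phi x) (xi *m g x) W_smooth W_convex.
have symA : A^T = A by exact: derive_hessian_sym.
have B2 := mxtrace_sqr_ge0 (uG x) (symg x) (@hessian_posdef x) symA.
have trB : \tr (connection_mx Phi xi x *m connection_mx Phi xi x) =
    4^-1 * \tr (A *m invmx (g x) *m (A *m invmx (g x))).
  rewrite -scalemxAl -scalemxAr !mxtraceZ mulrA -invfM; congr (_^-1 * _).
  by rewrite -natrM.
(* This holds since [xi A = 2 eta g] by definition of the connection matrix, and [A] and [g] are
   symmetric. *)
have qA : dotp (q x *m A) xi = 2 * dotp (q x *m g x) eta.
  rewrite /eta /connection_mx -scalemxAr mulmxA [X in 2 * X]dotpC dotpZl mulrA.
  rewrite mulfV ?pnatr_eq0// mul1r dotp_mulmx symA [RHS]dotp_mulmx.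
  by rewrite trmx_inv symg (mulmxK (uG x)) dotpC.
(* The Monge-Ampere equation, differentiated logarithmically along [eta]; the 2 undoes the half in
   the connection matrix. *)
have MA : dotp (gradient V x) eta =
    dotp (q x *m g x) eta - 2 * \tr (connection_mx Phi eta x).
  have deta : is_derive x eta g ('D_eta g x).
    exact/derivableP/diff_derivable/differentiable_hessian.
  rewrite dotpC dotp_gradient//.
  rewrite (derive_log_det (dV x) (dw x) deta (uG x) monge_ampere) Dw.
  rewrite /connection_mx mxtraceZ mulrA mulfV ?pnatr_eq0// mul1r.
  by rewrite dotp_mulmx symg dotpC.
have W2' : 0 <=
    dotp (xi *m g x *m hessian W (gradient Phi x) *m g x) xi.
  by rewrite dotp_mulmx symg.
(* Here [tb] stands for [tr B(eta)]. Substituting the three equations cancels it together with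
   [dotp r e], leaving [s / 4 + (dotp a z + dotp b z) / 2]. *)
have total (a b c v r z e : 'rV[R]_d) (t tb s : R) :
    t = 4^-1 * s -> dotp c z = 2 * dotp r e ->
    dotp v e = dotp r e - 2 * tb ->
    0 <= dotp a z -> 0 <= dotp b z -> 0 <= s ->
    0 <= t - tb + (dotp (2^-1 *: (a + (b + c))) z - dotp (2^-1 *: (v + r)) e).
  move=> -> cz ve; rewrite !dotpZl !dotpDl cz ve.
  by move: (dotp a z) (dotp b z) (dotp r e); clear => *; lra.
exact: (total _ _ _ _ _ _ _ _ _ _ trB qA MA V2 W2' B2).
Qed.
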